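(* Let $k\in\mathbb{N}$ and $n\in\mathbb{N}$. For a finite group $G$ acting on a finite set $X$, let $M_k(G,X)$ denote the number of orbits of $G$ acting diagonally on $X^k$. (i) If $G=(\mathbb{Z}/n\mathbb{Z})^\times$ acts on $X=\mathbb{Z}/n\mathbb{Z}$ by multiplication, then $M_k(G,X)=M_k(n)$. (ii) Let $G=\left\{\begin{pmatrix}1&0\\ b&d\end{pmatrix}:\ b\in\mathbb{Z}/n\mathbb{Z},\ d\in(\mathbb{Z}/n\mathbb{Z})^\times\right\}\cong(\mathbb{Z}/n\mathbb{Z})^\times\ltimes\mathbb{Z}/n\mathbb{Z}$ act on $X=(\{1\}\times\mathbb{Z}/n\mathbb{Z})\times(\{0\}\times\mathbb{Z}/n\mathbb{Z})$, where a pair $(v,w)\in X$ is viewed as a pair of column vectors and $g\cdot(v,w)=(gv,gw)$. Then $M_k(G,X)=M_{2k-1}(n)$. (iii) For a prime $\ell$, if $G=\mathrm{GL}_2(\mathbb{Z}/\ell\mathbb{Z})$ acts naturally on $X=\mathbb{Z}/\ell\mathbb{Z}\times\mathbb{Z}/\ell\mathbb{Z}$, then $$M_k(G,X)=\frac{\ell^4-2\ell^3-\ell^2+3\ell}{(\ell^2-\ell)(\ell^2-1)}+\ell^k\frac{\ell^3-2\ell-1}{(\ell^2-\ell)(\ell^2-1)}+\ell^{2k}\frac{1}{(\ell^2-\ell)(\ell^2-1)}.$$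
   Context: For $n\in\mathbb{N}$ and integer $k\ge0$, $M_k(n)=\sum_{d,e\ge1,\ de\mid n}\frac{d^k\mu(e)}{\varphi(de)}$, with $\mu$ the Möbius function and $\varphi$ Euler's function. *)

(* Defs.v *)
From HB Require Import structures.
From mathcomp Require Import all_boot all_order all_algebra.
From mathcomp Require Import all_fingroup all_solvable.

Set Implicit Arguments.
Unset Strict Implicit.
Unset Printing Implicit Defensive.

Import GRing.Theory.
Local Open Scope ring_scope.

Definition moebius (n : nat) : int :=
  if (0 < n)%N && all (fun p => logn p n == 1%N) (primes n)
  then (-1) ^+ size (primes n) else 0.

(* M_k(n).  For n > 0, the condition d * e %| n forces d, e <= n, so the bounds
   of the sums do not discard any pair (d, e) with d, e >= 1. *)
Definition Msum (k n : nat) : rat :=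
  \sum_(1 <= d < n.+1) \sum_(1 <= e < n.+1 | (d * e %| n)%N)
    (d ^ k)%N%:R * (moebius e)%:~R / (totient (d * e)%N)%:R.

(* M_k(G, X), for an action of G on a type containing the G-stable set X;
   (to * k)%act is the diagonal action on k-tuples. *)
Definition Morb (aT : finGroupType) (T : finType) (to : {action aT &-> T})
    (G : {group aT}) (X : {set T}) (k : nat) : nat :=
  #|orbit (to * k) G @: [set t : k.-tuple T | all [in X] t]|.

(* MathComp actions are right actions; a left action la is turned into the
   right action x, g |-> g^-1 . x, which has the same orbits. *)
Definition left_action (gT : finGroupType) (T : finType) (la : gT -> T -> T)
    (la1 : forall x, la 1%g x = x)
    (laM : forall g h x, la (g * h)%g x = la g (la h x)) : {action gT &-> T}.
Proof.
apply: (@TotalAction gT T (fun x g => la g^-1%g x)).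
- by move=> x; rewrite invg1.
- by move=> x g h; rewrite invMg laM.
Defined.

Lemma left_actionE (gT : finGroupType) (T : finType) (la : gT -> T -> T)
    (la1 : forall x, la 1%g x = x)
    (laM : forall g h x, la (g * h)%g x = la g (la h x)) (x : T) (g : gT) :
  left_action la1 laM x g = la g^-1%g x.
Proof. by []. Qed.

Lemma orbit_left_action (gT : finGroupType) (T : finType) (la : gT -> T -> T)
    (la1 : forall x, la 1%g x = x)
    (laM : forall g h x, la (g * h)%g x = la g (la h x))
    (G : {group gT}) (x : T) :
  orbit (left_action la1 laM) G x = [set la g x | g in G].
Proof.
apply/setP=> y; apply/orbitP/imsetP => [[g Gg <-]|[g Gg ->]].
  by exists g^-1%g; rewrite ?groupV.
by exists g^-1%g; rewrite ?groupV // left_actionE invgK.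
Qed.

Lemma orbit_left_action_diag (gT : finGroupType) (T : finType)
    (la : gT -> T -> T) (la1 : forall x, la 1%g x = x)
    (laM : forall g h x, la (g * h)%g x = la g (la h x))
    (G : {group gT}) (k : nat) (t : k.-tuple T) :
  orbit (left_action la1 laM * k) G t = [set [tuple of map (la g) t] | g in G].
Proof.
apply/setP=> y; apply/orbitP/imsetP => [[g Gg <-]|[g Gg ->]].
  by exists g^-1%g; rewrite ?groupV.
exists g^-1%g; rewrite ?groupV //; apply: val_inj => /=.
by apply: eq_map => x; rewrite invgK.
Qed.

Definition col_mul (R : finComUnitRingType) (g : {'GL_2[R]}) (v : 'cV[R]_2) :
  'cV[R]_2 := GLval g *m v.

Lemma col_mul1 (R : finComUnitRingType) (v : 'cV[R]_2) :
  col_mul 1%g v = v.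
Proof. exact: mul1mx. Qed.

Lemma col_mulM (R : finComUnitRingType) (g h : {'GL_2[R]}) (v : 'cV[R]_2) :
  col_mul (g * h)%g v = col_mul g (col_mul h v).
Proof. by rewrite /col_mul mulmxA. Qed.

Definition col_pair_mul (R : finComUnitRingType) (g : {'GL_2[R]})
    (p : 'cV[R]_2 * 'cV[R]_2) : 'cV[R]_2 * 'cV[R]_2 :=
  (col_mul g p.1, col_mul g p.2).

Lemma col_pair_mul1 (R : finComUnitRingType) (p : 'cV[R]_2 * 'cV[R]_2) :
  col_pair_mul 1%g p = p.
Proof. by case: p => v w; rewrite /col_pair_mul !col_mul1. Qed.

Lemma col_pair_mulM (R : finComUnitRingType) (g h : {'GL_2[R]})
    (p : 'cV[R]_2 * 'cV[R]_2) :
  col_pair_mul (g * h)%g p = col_pair_mul g (col_pair_mul h p).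
Proof. by rewrite /col_pair_mul !col_mulM. Qed.

Definition col_action (R : finComUnitRingType) :=
  left_action (@col_mul1 R) (@col_mulM R).

Definition col_pair_action (R : finComUnitRingType) :=
  left_action (@col_pair_mul1 R) (@col_pair_mulM R).

(* 'Z_n is the ring Z/n only for n > 1, 'Z_1 being Z/2.  The library's
   Zp n : {set 'Z_n} is all of 'Z_n for n > 1 and {0} for n = 1, so Zp n and
   units_Zp n model Z/n and (Z/n)^* for every n > 0. *)

Definition affine_mx (n : nat) (b d : 'Z_n) : 'M['Z_n]_2 :=
  block_mx (1%:M : 'M_1) (0 : 'M_1) (b%:M : 'M_1) (d%:M : 'M_1).

Definition affine_set (n : nat) : {set {'GL_2['Z_n]}} :=
  [set g : {'GL_2['Z_n]} | [exists b in Zp n, exists d in units_Zp n,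
              GLval g == affine_mx b (val d)]].

Lemma mem_ZpDM (n : nat) (a b c : 'Z_n) :
  a \in Zp n -> b \in Zp n -> a + c * b \in Zp n.
Proof.
rewrite /Zp; case: ifP => _; first by rewrite !inE.
by rewrite !inE => /eqP-> /eqP->; apply/eqP; rewrite mulr0 addr0.
Qed.

Lemma affine_mxM (n : nat) (b d b' d' : 'Z_n) :
  affine_mx b d *m affine_mx b' d' = affine_mx (b + d * b') (d * d').
Proof.
rewrite [LHS](@mulmx_block _ 1 1 1 1 1 1) !mul1mx !mul0mx !mulmx0 !addr0 !add0r.
by rewrite mulmx1 -!scalar_mxM -raddfD.
Qed.

Lemma affine_group_set (n : nat) : group_set (affine_set n).
Proof.
apply/group_setP; split=> [|g h]; rewrite !inE.
  apply/exists_inP; exists 0; first exact: group1.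
  apply/exists_inP; exists 1%g; first by rewrite inE.
  by apply/eqP; rewrite GL_1E /affine_mx raddf0 -scalar_mx_block.
move=> /exists_inP[b Zb /exists_inP[d _ /eqP gE]].
move=> /exists_inP[b' Zb' /exists_inP[d' _ /eqP hE]].
apply/exists_inP; exists (b + val d * b'); first exact: mem_ZpDM.
apply/exists_inP; exists (d * d')%g; first by rewrite inE.
by rewrite GL_MxE gE hE affine_mxM.
Qed.

Canonical affine_group (n : nat) : {group {'GL_2['Z_n]}} :=
  Group (affine_group_set n).

Definition affine_vec (n : nat) (c x : 'Z_n) : 'cV['Z_n]_2 :=
  col_mx (c%:M : 'M_1) (x%:M : 'M_1).

Definition affine_line (n : nat) (c : 'Z_n) : {set 'cV['Z_n]_2} :=
  [set affine_vec c x | x in Zp n].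

Definition affine_pairs (n : nat) : {set 'cV['Z_n]_2 * 'cV['Z_n]_2} :=
  setX (affine_line 1) (affine_line 0).

Lemma affine_mx_vec (n : nat) (b d c x : 'Z_n) :
  affine_mx b d *m affine_vec c x = affine_vec c (b * c + d * x).
Proof.
rewrite [LHS](@mul_block_col _ 1 1 1 1 1) mul1mx mul0mx addr0.
by rewrite -!scalar_mxM -raddfD.
Qed.

Lemma affine_pairs_acts (n : nat) :
  [acts affine_group n, on affine_pairs n | col_pair_action 'Z_n].
Proof.
apply/subsetP => g; rewrite -groupV => Gg.
rewrite !inE /=; apply/subsetP => -[v w].
rewrite !inE /= => /andP[/imsetP[x Zx ->] /imsetP[y Zy ->]].
move: Gg; rewrite inE => /exists_inP[b Zb /exists_inP[d _ /eqP gE]].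
rewrite /col_mul gE !affine_mx_vec; apply/andP; split; apply: imset_f.
  by rewrite mulr1 mem_ZpDM.
by rewrite mulr0; apply: mem_ZpDM => //; apply: group1.
Qed.

Lemma units_Zp_acts (n : nat) : [acts units_Zp n, on Zp n | 'U%act].
Proof.
apply/subsetP => u _; rewrite !inE /=; apply/subsetP => x Zx.
rewrite inE /= FinRing.unit_actE -[_ * _]add0r mulrC.
by apply: mem_ZpDM => //; apply: (group1 (Zp_group n)).
Qed.

(* Main.v *)
(** (i) The number of orbits is the sum of 1/|orbit t| over the tuples t.  The
    orbit of t under the units has phi(c) elements, where c is the additive order
    of t, because (Z/n)^* -> (Z/c)^* is onto; Moebius inversion writes 1/phi(c)
    as a sum over pairs e | D with c | D/e, and (D/e)^k tuples have order
    dividing D/e.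
    (ii) The translations make the first coordinate x_0 vanish, which leaves the
    units acting on 2k-1 coordinates.
    (iii) The fixed points of g in GL_2(F_q) number 1, q or q^2 (only for g = 1),
    so by Burnside the number of orbits times |GL_2(F_q)| is a0 + a1 q^k + q^2k;
    the unknown a0 and a1 follow from k = 0 (the order of the group) and from
    k = 1 (two orbits: the zero vector and the others). *)

Require Import Defs.
From mathcomp Require Import all_boot all_order all_algebra.
From mathcomp Require Import all_fingroup all_solvable.
From mathcomp Require Import mxabelem ring lra zify.

Set Implicit Arguments.
Unset Strict Implicit.
Unset Printing Implicit Defensive.

Import Order.TTheory GRing.Theory Num.Theory.
Local Open Scope ring_scope.

(** * The Möbius function and its divisor sums *)

(** If p divides f, then p occurs at least twice in p f. Otherwise p f gains exactly one prime,
    which flips the sign and leaves the other exponents alone. *)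
Lemma moebius_mul_prime (p f : nat) : prime p -> (0 < f)%N ->
  moebius (p * f) = if (p %| f)%N then 0 else - moebius f.
Proof.
move=> p_pr f_gt0; have p_gt0 := prime_gt0 p_pr.
have pf_gt0 : (0 < p * f)%N by rewrite muln_gt0 p_gt0.
rewrite /moebius pf_gt0 f_gt0 /=; have [pf|npf] := boolP (p %| f)%N.
  rewrite ifN //; apply/allPn; exists p.
    by rewrite mem_primes p_pr pf_gt0 dvdn_mulr.
  rewrite lognM // (pfactorK 1 p_pr) /=.
  by have : (0 < logn p f)%N; [rewrite logn_gt0 mem_primes p_pr f_gt0 | case: logn].
have perm_pf : perm_eq (primes (p * f)) (p :: primes f).
  apply: uniq_perm; rewrite ?primes_uniq //=.
    by rewrite primes_uniq mem_primes (negPf npf) !andbF.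
  by move=> r; rewrite primesM // primes_prime // !inE.
have pfE : logn p f = 0%N.
  by apply/eqP; rewrite -leqn0 leqNgt logn_gt0 mem_primes (negPf npf) !andbF.
rewrite (perm_all _ perm_pf) (perm_size perm_pf) /= lognM // (pfactorK 1 p_pr).
rewrite pfE /= exprS mulN1r.
rewrite (@eq_in_all _ _ (fun r => logn r f == 1%N)); first by case: ifP; rewrite ?oppr0.
move=> r; rewrite mem_primes => /and3P[r_pr _ rf].
by rewrite lognM // logn_prime //; case: (r =P p) => // rp; rewrite -rp rf in npf.
Qed.

Lemma big_divisors (R : Type) (idx : R) (op : Monoid.com_law idx) (m : nat)
    (F : nat -> R) : (0 < m)%N ->
  \big[op/idx]_(1 <= e < m.+1 | (e %| m)%N) F e
    = \big[op/idx]_(e <- divisors m) F e.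
Proof.
move=> m_gt0; rewrite -big_filter; apply: perm_big.
apply: uniq_perm; rewrite ?filter_uniq ?iota_uniq ?divisors_uniq // => e.
rewrite mem_filter mem_index_iota -dvdn_divisors // ltnS.
case: (boolP (e %| m)%N) => //= em.
by rewrite (dvdn_gt0 m_gt0 em) dvdn_leq.
Qed.

(** For m = p m', the divisors of m split into the products p f with f dividing m' and the divisors
    prime to p, which are those of m'. The terms of p f and f cancel when p does not divide f; the
    other terms vanish. *)
Lemma sum_moebius (m : nat) : (0 < m)%N ->
  \sum_(e <- divisors m) moebius e = (m == 1%N)%:R.
Proof.
move=> m_gt0; have [->|m_neq1] := eqVneq m 1%N; first by rewrite big_seq1.
have [p p_pr pm] : exists2 p, prime p & (p %| m)%N.
  by exists (pdiv m); rewrite ?pdiv_dvd // pdiv_prime //; case: m m_gt0 m_neq1 => [|[]].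
have p_gt0 := prime_gt0 p_pr.
have [m' mE] : exists m', m = (p * m')%N.
  by case/dvdnP: pm => m' ->; exists m'; apply: mulnC.
have m'_gt0 : (0 < m')%N by move: m_gt0; rewrite mE muln_gt0 => /andP[].
rewrite (bigID (fun e => p %| e)%N) /= -big_filter.
rewrite (@perm_big _ _ _ _ _ [seq (p * f)%N | f <- divisors m']); last first.
  apply: uniq_perm; rewrite ?filter_uniq ?divisors_uniq //.
    rewrite map_inj_uniq ?divisors_uniq // => x y /eqP.
    by rewrite eqn_pmul2l // => /eqP.
  move=> e; rewrite mem_filter -dvdn_divisors //.
  apply/andP/mapP => [[/dvdnP[f ->] em]|[f]].
    exists f; last by rewrite mulnC.
    by rewrite -dvdn_divisors // -(@dvdn_pmul2l p) // -mE mulnC.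
  by rewrite -dvdn_divisors // => fm ->; rewrite mE dvdn_pmul2l // dvdn_mulr.
rewrite big_map -[X in _ + X]big_filter.
rewrite (@perm_big _ _ _ _ [seq f <- divisors m | ~~ (p %| f)%N]
           [seq f <- divisors m' | ~~ (p %| f)%N]); last first.
  apply: uniq_perm; rewrite ?filter_uniq ?divisors_uniq // => e.
  rewrite !mem_filter -(dvdn_divisors _ m_gt0) -(dvdn_divisors _ m'_gt0).
  case: (boolP (p %| e)%N) => //= pe.
  by rewrite mE Gauss_dvdr // coprime_sym prime_coprime.
rewrite big_filter [X in _ + X]big_mkcond -big_split /= big_seq big1 // => f.
rewrite -dvdn_divisors // => fm; rewrite moebius_mul_prime ?(dvdn_gt0 _ fm) //.
by case: ifP => _ /=; rewrite ?addr0 ?addNr.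
Qed.

(** * Counting orbits by size, and elements of given order *)

(** Each orbit contributes as many equal terms as it has elements, hence 1 in all. *)
Lemma card_orbits_sum (aT : finGroupType) (T : finType)
    (to : {action aT &-> T}) (G : {group aT}) (S : {set T}) :
  [acts G, on S | to] ->
  #|orbit to G @: S|%:R = \sum_(x in S) #|orbit to G x|%:R^-1 :> rat.
Proof.
move=> actsG; rewrite (set_partition_big _ (orbit_partition actsG)) /=.
rewrite -sum1_card natr_sum; apply: eq_bigr => O /imsetP[x Sx ->].
rewrite (eq_bigr (fun _ => #|orbit to G x|%:R^-1)) => [|y xy]; last first.
  by rewrite (orbit_eqP xy).
rewrite sumr_const -[RHS]mulr_natr mulVf // pnatr_eq0 -lt0n.
by apply/card_gt0P; exists x; apply: orbit_refl.
Qed.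

(** These elements form the unique subgroup of order d, generated by the power |G|/d of a
    generator. *)
Lemma card_order_dvd_cyclic (gT : finGroupType) (G : {group gT}) (d : nat) :
  cyclic G -> (d %| #|G|)%N -> #|[set x in G | (#[x]%g %| d)%N]| = d.
Proof.
move=> cycG dG; have [g Gg] := cyclicP cycG.
have d_gt0 : (0 < d)%N := dvdn_gt0 (cardG_gt0 G) dG.
pose H := <[g ^+ (#|G| %/ d)]>%G.
have cardH : #|H| = d.
  rewrite /H -orderE orderXdiv; first by rewrite orderE -Gg divnA // mulKn.
  by rewrite orderE -Gg; apply/dvdnP; exists d; rewrite mulnC divnK.
have sHG : H \subset G by rewrite cycle_subG Gg mem_cycle.
rewrite -[RHS]cardH; apply: eq_card => x; rewrite inE.
case: (boolP (x \in G)) => [Gx|nGx] /=; last first.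
  by apply/esym/negbTE; apply: contra nGx; apply: (subsetP sHG).
by rewrite -[RHS]cycle_subG -(cardSg_cyclic cycG _ sHG) ?cycle_subG // cardH.
Qed.

(** * Orbits of the units on tuples over Z/n *)

(** Surjectivity of (Z/n)^* onto (Z/d)^*. With r the part of n prime to m, the number m + r d works:
    each prime of n divides exactly one of m and r d. *)
Lemma lift_coprime (n d m : nat) : (0 < n)%N -> (d %| n)%N -> coprime d m ->
  exists2 m', coprime n m' & m' = m %[mod d].
Proof.
move=> n_gt0 dn co_dm; have d_gt0 := dvdn_gt0 n_gt0 dn.
(* For m = 0 the set [\pi(m)] is empty and r below would be n, so m is first replaced by m + d. *)
wlog m_gt0 : m co_dm / (0 < m)%N => [IH|].
  have [||m' co_m' m'E] := IH (m + d)%N; rewrite ?addn_gt0 ?d_gt0 ?orbT //.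
    by rewrite -coprime_modr modnDr coprime_modr.
  by exists m'; rewrite // m'E modnDr.
pose r := (n`_(\pi(m)^'))%N; have r_gt0 : (0 < r)%N by apply: part_gt0.
have r_primes p : prime p -> (p %| r)%N = (p %| n)%N && ~~ (p %| m)%N.
  move=> p_pr; have : (p \in primes r) = (p \in primes n) && (p \notin primes m).
    by rewrite primes_part mem_filter andbC.
  by rewrite !mem_primes p_pr r_gt0 n_gt0 m_gt0.
exists (m + r * d)%N; last by rewrite addnC modnMDl.
rewrite coprime_has_primes ?addn_gt0 ?m_gt0 //.
apply/hasPn => p; rewrite /= !mem_primes => /and3P[p_pr _ pm'].
rewrite p_pr n_gt0 /=; apply/negP => pn.
have [pm|npm] := boolP (p %| m)%N; last first.
  by rewrite dvdn_addl ?(negPf npm) // ?dvdn_mulr ?r_primes ?pn in pm'.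
move: pm'; rewrite dvdn_addr // Euclid_dvdM // r_primes // pn pm /= => pd.
by have := coprime_dvdl pd co_dm; rewrite prime_coprime // pm.
Qed.

(** The order of t in the direct power of [gT]; over ['Z_n] it is the additive order. *)
Definition tuple_order (gT : finGroupType) (k : nat) (t : k.-tuple gT) : nat :=
  \big[lcmn/1%N]_(i < k) #[tnth t i]%g.

Lemma tuple_order_dvd (gT : finGroupType) (k m : nat) (t : k.-tuple gT) :
  (tuple_order t %| m)%N = all (fun x => #[x]%g %| m)%N t.
Proof.
by apply/dvdn_biglcmP/all_tnthP => [tm i|tm i _]; apply: tm.
Qed.

Lemma Zp_mul_nat (n : nat) (x u : 'Z_n) : x * u = x *+ u.
Proof. by rewrite -[in LHS](natr_Zp u) mulr_natr. Qed.

Definition tuple_scale (n k m : nat) (t : k.-tuple 'Z_n) : k.-tuple 'Z_n :=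
  [tuple of map (fun x => x *+ m) t].

(** Coordinatewise, m t = m' t means that the order of every entry divides m - m', hence that their
    lcm does. *)
Lemma eq_tuple_scale (n k m m' : nat) (t : k.-tuple 'Z_n) :
  tuple_scale m t = tuple_scale m' t <-> m = m' %[mod tuple_order t].
Proof.
wlog lemm : m m' / (m' <= m)%N => [IH|].
  by case: (leqP m' m) => [|/ltnW]/IH // [mm mm']; split=> /esym; [move/mm | move/mm'].
transitivity (tuple_order t %| m - m')%N; last first.
  by rewrite -eqn_mod_dvd //; split=> /eqP.
rewrite tuple_order_dvd; split=> [tE|/allP tE].
  apply/all_tnthP => i; rewrite order_dvdn FinRing.zmodXgE mulrnBr //.
  have := congr1 (fun s => tnth s i) tE; rewrite !tnth_map => ->.
  by rewrite subrr.
apply: eq_from_tnth => i; rewrite !tnth_map; apply/eqP; rewrite -subr_eq0 -mulrnBr //.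
by have := tE _ (mem_tnth i t); rewrite order_dvdn FinRing.zmodXgE.
Qed.

(** The orbit consists of the m t with m < D prime to D: a unit of Z/n is prime to D, and conversely
    each such m lifts to a unit of Z/n. *)
Lemma card_orbit_units_Zp (n k : nat) (t : k.-tuple 'Z_n) :
  (0 < n)%N -> (tuple_order t %| n)%N ->
  #|orbit ('U * k) (units_Zp_group n) t| = totient (tuple_order t).
Proof.
move=> n_gt0; set D := tuple_order t => Dn; have D_gt0 := dvdn_gt0 n_gt0 Dn.
pose f (m : 'I_D) := tuple_scale m t.
have actE u : n_act 'U t u = tuple_scale (FinRing.uval u) t.
  by apply: eq_from_tnth => i; rewrite !tnth_map /= FinRing.unit_actE Zp_mul_nat.
have f_inj : injective f.
  move=> m m' /eq_tuple_scale; rewrite !modn_small //; apply: val_inj.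
rewrite totient_count_coprime big_mkord.
rewrite (_ : orbit _ _ _ = f @: [set m : 'I_D | coprime D m]).
  rewrite card_imset // -sum1dep_card big_mkcond; apply: eq_bigr => m _.
  by case: coprime.
apply/setP => y; apply/orbitP/imsetP => [[u _ <-]|[m]].
  rewrite /= actE; pose v := FinRing.uval u^-1%g.
  have co_Du : coprime D (FinRing.uval u).
    (* As u v t = t, the product u v is 1 modulo the order of t. *)
    have : (FinRing.uval u * v)%N = 1%N %[mod D].
      apply/eq_tuple_scale/eq_from_tnth => i; rewrite !tnth_map mulrnA -!Zp_mul_nat.
      by rewrite -mulrA -FinRing.val_unitM mulgV mulr1.
    move=> uv; have : coprime D (FinRing.uval u * v).
      by rewrite -coprime_modr uv coprime_modr coprimen1.
    by rewrite coprimeMr => /andP[].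
  exists (Ordinal (ltn_pmod (FinRing.uval u) D_gt0)); rewrite ?inE ?coprime_modr //.
  by apply/eq_tuple_scale; rewrite modn_mod.
rewrite inE => co_Dm ->; have [m' co_nm' mm'] := lift_coprime n_gt0 Dn co_Dm.
have [n_gt1|n_le1] := ltnP 1 n.
  have Um' : (m'%:R : 'Z_n) \is a GRing.unit by rewrite unitZpE.
  exists (FinRing.unit 'Z_n Um'); rewrite ?inE //= actE.
  transitivity (tuple_scale m' t); last by apply/eq_tuple_scale.
  by apply: eq_from_tnth => i; rewrite !tnth_map -Zp_mul_nat mulr_natr.
(* Here n = 1 and ['Z_n] is Z/2. Since D divides 1, all scalings of t agree and the identity serves
   as the unit. *)
exists 1%g; rewrite ?inE // act1.
transitivity (tuple_scale 1 t).
  by apply: eq_from_tnth => i; rewrite tnth_map.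
have D1 : D = 1%N.
  apply/eqP; rewrite -dvdn1 (dvdn_trans Dn) //.
  by rewrite (_ : n = 1%N) //; apply/eqP; rewrite eqn_leq n_le1.
have modD a b : a = b %[mod D] by rewrite D1 !modn1.
by apply/eq_tuple_scale; apply: modD.
Qed.


(** * Evaluation of the orbit sum for the units *)

Lemma card_tuple_all (T : finType) (Y : {set T}) (k : nat) :
  #|[set t : k.-tuple T | all [in Y] t]| = (#|Y| ^ k)%N.
Proof.
rewrite -[k in RHS]card_ord -card_ffun_on.
pose f (t : k.-tuple T) := [ffun i => tnth t i].
have f_inj : injective f.
  by move=> s t /ffunP st; apply: eq_from_tnth => i; have := st i; rewrite !ffunE.
rewrite -(card_imset _ f_inj); apply: eq_card => g.
apply/imsetP/ffun_onP => [[t] | gY].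
  by rewrite inE => /all_tnthP tY -> i; rewrite ffunE; apply: tY.
exists [tuple g i | i < k]; last by apply/ffunP=> i; rewrite ffunE tnth_mktuple.
by rewrite inE; apply/all_tnthP => i; rewrite tnth_mktuple; apply: gY.
Qed.

Lemma acts_diag (aT : finGroupType) (T : finType) (to : {action aT &-> T})
    (G : {group aT}) (X : {set T}) (k : nat) :
  [acts G, on X | to] ->
  [acts G, on [set t : k.-tuple T | all [in X] t] | (to * k)%act].
Proof.
move=> actsG; apply/actsP => g Gg t; rewrite !inE all_map.
by apply: eq_all => x /=; rewrite (actsP actsG).
Qed.

(** Reindexing by D = d e, so that d = D / e. *)
Lemma Msum_divisors (k n : nat) : (0 < n)%N ->
  Msum k n = \sum_(D <- divisors n) \sum_(e <- divisors D)
    ((D %/ e) ^ k)%N%:R * (moebius e)%:~R / (totient D)%:R.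
Proof.
move=> n_gt0; rewrite /Msum.
rewrite (exchange_big_dep xpredT) //=.
transitivity (\sum_(1 <= e < n.+1) \sum_(D <- divisors n | (e %| D)%N)
    ((D %/ e) ^ k)%N%:R * (moebius e)%:~R / (totient D)%:R : rat).
  apply: eq_big_nat => e /andP[e_gt0 _]; rewrite -big_filter.
  rewrite -[RHS]big_filter.
  rewrite [RHS](@perm_big _ _ _ _ _
    [seq (d * e)%N | d <- index_iota 1 n.+1 & (d * e %| n)%N]); last first.
    apply: uniq_perm; rewrite ?filter_uniq ?divisors_uniq //.
      rewrite map_inj_uniq ?filter_uniq ?iota_uniq // => x y /eqP.
      by rewrite eqn_pmul2r // => /eqP.
    move=> D; rewrite mem_filter -dvdn_divisors //.
    apply/andP/mapP => [[/dvdnP[d ->] Dn]|[d]].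
      exists d; rewrite // mem_filter Dn mem_index_iota ltnS /=.
      have := dvdn_gt0 n_gt0 Dn; rewrite muln_gt0 => /andP[-> _] /=.
      by rewrite dvdn_leq // (dvdn_trans _ Dn) ?dvdn_mulr.
    by rewrite mem_filter => /andP[den _] ->; rewrite dvdn_mull.
  by rewrite big_map; apply: eq_bigr => d _; rewrite mulnK.
rewrite (exchange_big_dep xpredT) //=; apply: eq_big_seq => D.
rewrite -dvdn_divisors // => Dn; have D_gt0 := dvdn_gt0 n_gt0 Dn.
rewrite -big_divisors //.
have Dle : (D.+1 <= n.+1)%N by rewrite ltnS dvdn_leq.
rewrite [RHS](big_nat_widen _ _ _ _ _ Dle); apply: eq_bigl => e.
by case: (boolP (e %| D)%N) => //= eD; rewrite ltnS dvdn_leq.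
Qed.

(* Moebius inversion turns the condition D = c into a sum over e | D / c. *)
Lemma sum_moebius_totient (c n : nat) : (0 < n)%N -> (c %| n)%N ->
  \sum_(D <- divisors n) \sum_(e <- divisors D | (c %| D %/ e)%N)
     (moebius e)%:~R / (totient D)%:R = (totient c)%:R^-1 :> rat.
Proof.
move=> n_gt0 cn; have c_gt0 := dvdn_gt0 n_gt0 cn.
transitivity (\sum_(D <- divisors n | D == c) (totient D)%:R^-1 : rat); last first.
  rewrite big_mkcond (bigD1_seq c) ?divisors_uniq -?dvdn_divisors //= eqxx.
  by rewrite big1 ?addr0 // => D /negPf->.
rewrite [RHS]big_mkcond; apply: eq_big_seq => D; rewrite -dvdn_divisors // => Dn.
have D_gt0 := dvdn_gt0 n_gt0 Dn.
rewrite -mulr_suml; have [/dvdnP[m DE]|ncD] := boolP (c %| D)%N; last first.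
  rewrite ifN; last by apply: contra ncD => /eqP->.
  rewrite big_seq_cond big1 ?mul0r // => e; rewrite -dvdn_divisors // => /andP[eD cDe].
  by rewrite (dvdn_trans cDe) ?dvdn_div in ncD.
have m_gt0 : (0 < m)%N by move: D_gt0; rewrite DE muln_gt0 => /andP[].
(* With D = m c, the condition that c divides D / e says that e divides m. *)
rewrite -big_filter (@perm_big _ _ _ _ _ (divisors m)); last first.
  apply: uniq_perm; rewrite ?filter_uniq ?divisors_uniq // => e.
  rewrite mem_filter -!dvdn_divisors //.
  apply/andP/idP => [[cDe /dvdnP[d Dd]]|/dvdnP[d md]].
    move: cDe D_gt0; rewrite Dd; case: e Dd => [|e] Dd; first by rewrite muln0.
    rewrite mulnK // => cd _; rewrite -(@dvdn_pmul2r c) // -DE Dd mulnC.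
    by rewrite dvdn_pmul2r.
  have e_gt0 : (0 < e)%N by move: m_gt0; rewrite md muln_gt0 => /andP[].
  by rewrite DE md mulnAC mulnK ?dvdn_mull.
rewrite -rmorph_sum /= sum_moebius // DE.
have [->|m1] := eqVneq m 1%N; first by rewrite mul1n eqxx mul1r.
by rewrite mul0r ifN // -[X in _ != X]mul1n eqn_pmul2r.
Qed.

Lemma Morb_units_Zp (k n : nat) : (0 < n)%N ->
  (Morb 'U%act (units_Zp_group n) (Zp n) k)%:R = Msum k n.
Proof.
move=> n_gt0; rewrite Msum_divisors //.
have order_n x : x \in Zp n -> (#[x]%g %| n)%N.
  by move=> Zx; rewrite -[X in (_ %| X)%N](card_Zp n_gt0) order_dvdG.
rewrite card_orbits_sum; last exact: acts_diag (units_Zp_acts n).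
pose F (t : k.-tuple 'Z_n) D := \sum_(e <- divisors D | (tuple_order t %| D %/ e)%N)
     (moebius e)%:~R / (totient D)%:R : rat.
rewrite (eq_bigr (fun t => \sum_(D <- divisors n) F t D)) => [|t]; last first.
  rewrite inE => /allP tZ.
  have tn : (tuple_order t %| n)%N.
    by rewrite tuple_order_dvd; apply/allP => x /tZ; apply: order_n.
  by rewrite card_orbit_units_Zp // sum_moebius_totient.
rewrite exchange_big; apply: eq_big_seq => D; rewrite -dvdn_divisors // => Dn.
rewrite /F (exchange_big_dep xpredT) //=; apply: eq_big_seq => e.
rewrite -dvdn_divisors ?(dvdn_gt0 n_gt0 Dn) // => eD.
rewrite -mulrA sumr_const -[LHS]mulr_natl; congr (_%:R * _).
have den : (D %/ e %| #|Zp n|)%N by rewrite card_Zp // (dvdn_trans _ Dn) ?dvdn_div.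
(* The power (D / e)^k counts the tuples over the elements of order dividing D / e in the cyclic
   group [Zp n], that is, the tuples whose own order divides D / e. *)
rewrite -[X in (X ^ k)%N](card_order_dvd_cyclic _ den); last first.
  by rewrite /= /Zp; case: ifP => _; rewrite ?cyclic1 // Zp_cycle cycle_cyclic.
rewrite -card_tuple_all; apply: eq_card => t; rewrite unfold_in !inE.
rewrite tuple_order_dvd -all_predI.
by apply: eq_all => x /=; rewrite inE.
Qed.

(** * The affine group: reduction to the units *)

(** A tool for comparing two numbers of orbits: with orbit maps for r and r', f induces a bijection
    between orbits as soon as its image meets every orbit, even if f is not onto. *)
Lemma card_imset_kernel (T T' U U' : finType) (S : {set T}) (S' : {set T'})
    (f : T -> T') (r : T -> U) (r' : T' -> U') :
  {in S, forall x, f x \in S'} ->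
  {in S', forall y, exists2 x, x \in S & r' (f x) = r' y} ->
  {in S &, forall x y, r x = r y <-> r' (f x) = r' (f y)} ->
  #|r @: S| = #|r' @: S'|.
Proof.
move=> fS surj kerE.
(* The map induced on classes: all values r' (f x) with r x = u agree, so any choice will do. *)
pose g u := [pick v | [exists x in S, (r x == u) && (r' (f x) == v)]].
have gE x : x \in S -> g (r x) = Some (r' (f x)).
  move=> Sx; rewrite /g; case: pickP => [v /exists_inP[y Sy /andP[/eqP ryx /eqP <-]]|].
    by congr Some; apply/(kerE _ _ Sy Sx).
  by move/(_ (r' (f x)))/exists_inP; case; exists x; rewrite ?eqxx.
have g_inj : {in r @: S &, injective g}.
  move=> _ _ /imsetP[x Sx ->] /imsetP[y Sy ->]; rewrite !gE // => -[].
  by move/(kerE _ _ Sx Sy).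
rewrite -(card_in_imset g_inj) -[RHS](card_imset _ (@Some_inj _)).
apply: eq_card => o; apply/imsetP/imsetP => [[_ /imsetP[x Sx ->] ->]|].
  by exists (r' (f x)); rewrite ?gE // imset_f ?fS.
case=> _ /imsetP[y S'y ->] ->.
by have [x Sx <-] := surj y S'y; exists (r x); rewrite ?gE ?imset_f.
Qed.

Lemma affine_vec_inj (n : nat) (c : 'Z_n) : injective (affine_vec c).
Proof.
move=> x y xy; have [_ /matrixP/(_ 0 0)] := @eq_col_mx _ 1 1 1 _ _ _ _ xy.
by rewrite !mxE.
Qed.

Definition affine_seq (n : nat) (xs ys : seq 'Z_n) : seq ('cV['Z_n]_2 * 'cV['Z_n]_2) :=
  zip (map (affine_vec 1) xs) (map (affine_vec 0) ys).

(** Equal lengths keep [zip] from truncating, so both lists can be read off. *)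
Lemma affine_seq_inj (n : nat) (xs ys xs' ys' : seq 'Z_n) :
  size xs = size ys -> size xs' = size ys' ->
  affine_seq xs ys = affine_seq xs' ys' -> xs = xs' /\ ys = ys'.
Proof.
move=> sz sz' xyE; split; apply: inj_map (@affine_vec_inj n _) _ _ _.
  by have := congr1 unzip1 xyE; rewrite !unzip1_zip ?size_map ?sz ?sz' //; apply.
by have := congr1 unzip2 xyE; rewrite !unzip2_zip ?size_map ?sz ?sz' //; apply.
Qed.

(** The second vectors have top entry 0, so the translation part b moves only the x coordinates. *)
Lemma map_affine_seq (n : nat) (b d : 'Z_n) (g : {'GL_2['Z_n]}) (xs ys : seq 'Z_n) :
  GLval g = affine_mx b d ->
  map (col_pair_mul g) (affine_seq xs ys)
    = affine_seq (map (fun x => b + d * x) xs) (map ( *%R d) ys).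
Proof.
move=> gE; elim: xs ys => [|x xs IH] [|y ys] //=.
congr (_ :: _); last exact: IH.
by rewrite /col_pair_mul /col_mul /= gE !affine_mx_vec mulr1 mulr0 add0r.
Qed.

Lemma mem_affine_seq (n : nat) (xs ys : seq 'Z_n) :
  all [in Zp n] xs -> all [in Zp n] ys ->
  all [in affine_pairs n] (affine_seq xs ys).
Proof.
elim: xs ys => [|x xs IH] [|y ys] //= /andP[Zx Zxs] /andP[Zy Zys].
by apply/andP; split; [apply/setXP; split; apply: imset_f | apply: IH].
Qed.

Lemma affine_seqP (n : nat) (s : seq ('cV['Z_n]_2 * 'cV['Z_n]_2)) :
  all [in affine_pairs n] s ->
  exists xs ys, [/\ all [in Zp n] xs, all [in Zp n] ys,
    size xs = size s, size ys = size s & s = affine_seq xs ys].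
Proof.
elim: s => [_|[v w] s IH] /=; first by exists [::], [::].
case/andP=> /setXP[/imsetP[x Zx ->] /imsetP[y Zy ->]].
case/IH=> xs [ys [Zxs Zys szx szy sE]].
by exists (x :: xs), (y :: ys); split; rewrite /= ?Zx ?Zy ?szx ?szy // [in LHS]sE.
Qed.

Lemma affine_group_elt (n : nat) (b : 'Z_n) (u : {unit 'Z_n}) :
  b \in Zp n -> exists2 g, g \in affine_set n & GLval g = affine_mx b (val u).
Proof.
move=> Zb.
(* The inverse of x -> b + u x is x -> u^-1 x - u^-1 b. *)
have /mulmx1_unit[U _] :
    affine_mx b (val u) *m affine_mx (- (val u^-1%g * b)) (val u^-1%g) = 1%:M.
  rewrite affine_mxM mulrN mulrA -FinRing.val_unitM mulgV mul1r subrr.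
  by rewrite /affine_mx raddf0 -scalar_mx_block.
exists (Sub (affine_mx b (val u)) U) => //; rewrite inE.
by apply/exists_inP; exists b => //; apply/exists_inP; exists u; rewrite ?inE.
Qed.

Lemma affine_normal_subproof (n k : nat) (t : (k + k.+1).-tuple 'Z_n) :
  size (affine_seq (0 :: take k t) (drop k t)) == k.+1.
Proof.
rewrite size_zip /= !size_map size_takel ?size_drop size_tuple ?leq_addr //.
by rewrite addKn minnn.
Qed.

(* Translating by - x_0 brings any k+1 pairs ((1, x_i), (0, y_i)) to the case
   x_0 = 0, recorded by the 2k+1 numbers x_1, ..., x_k, y_0, ..., y_k. *)
Definition affine_normal (n k : nat) (t : (k + k.+1).-tuple 'Z_n) :
  k.+1.-tuple ('cV['Z_n]_2 * 'cV['Z_n]_2) := Tuple (affine_normal_subproof t).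

Lemma Morb_affine (n k : nat) :
  Morb (col_pair_action 'Z_n) (affine_group n) (affine_pairs n) k.+1
    = Morb 'U%act (units_Zp_group n) (Zp n) (k + k.+1).
Proof.
apply/esym; apply: (@card_imset_kernel _ _ _ _ _ _ (@affine_normal n k)).
- move=> t; rewrite !inE => /allP tZ; apply: mem_affine_seq.
    apply/andP; split; first exact: (group1 (Zp_group n)).
    by apply/allP => x /mem_take; apply: tZ.
  by apply/allP => x /mem_drop; apply: tZ.
- move=> T; rewrite inE => /affine_seqP[[|x0 xs] [ys [Zxs Zys sz_xs sz_ys TE]]].
    by rewrite (size_tuple T) in sz_xs.
  rewrite (size_tuple T) in sz_xs sz_ys; case: sz_xs => sz_xs.
  move: Zxs => /= /andP[Zx0 /allP Zxs].
  (* The coordinates of T after translation by - x0. The group element with b = x0 and d = 1 carries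
     this normal form back to T. *)
  pose t := map (fun x => x - x0) xs ++ ys.
  have sz_t : size t == (k + k.+1)%N by rewrite size_cat size_map sz_xs sz_ys.
  exists (Tuple sz_t).
    rewrite inE /= all_cat Zys andbT all_map; apply/allP => x /Zxs Zx /=.
    by rewrite -mulN1r mem_ZpDM.
  apply/esym/orbit_eqP; rewrite orbit_left_action_diag; apply/imsetP.
  have [g Gg gE] := affine_group_elt 1%g Zx0; exists g => //.
  apply: val_inj; rewrite /= TE (map_affine_seq _ _ gE) /=.
  rewrite take_size_cat ?drop_size_cat ?size_map // mulr0 addr0 -map_comp.
  congr (affine_seq (_ :: _) _).
    by rewrite -[LHS]map_id; apply: eq_map => x /=; rewrite mul1r addrC subrK.
  by rewrite -[LHS]map_id; apply: eq_map => x /=; rewrite mul1r.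
move=> s t _ _.
have sz (r : (k + k.+1).-tuple 'Z_n) : size (0 :: take k r) = size (drop k r).
  by rewrite /= size_takel ?size_drop size_tuple ?leq_addr // addKn.
split=> [/orbit_eqP/orbitP[u _ us]|/orbit_eqP].
  apply/orbit_eqP; rewrite orbit_left_action_diag; apply/imsetP.
  have [g Gg gE] := affine_group_elt u (group1 (Zp_group n)); exists g => //.
  apply: val_inj; rewrite /= (map_affine_seq _ _ gE) /= mulr0 addr0 -us /=.
  rewrite -map_take -map_drop; congr (affine_seq (_ :: _) _); apply: eq_map => x.
    by rewrite FinRing.unit_actE add0r mulrC.
  by rewrite FinRing.unit_actE mulrC.
rewrite orbit_left_action_diag => /imsetP[g].
rewrite inE => /exists_inP[b Zb /exists_inP[u _ /eqP gE]] /(congr1 val) /=.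
rewrite (map_affine_seq _ _ gE) => /affine_seq_inj[||]; rewrite ?size_map //.
(* Comparing the first coordinates, both 0, forces b = 0, so g acts through the unit u alone. *)
rewrite /= mulr0 addr0 => -[b0 st1] st2.
apply/orbit_eqP/orbitP; exists u; rewrite ?inE //; apply: val_inj => /=.
rewrite -(cat_take_drop k s) -[in LHS](cat_take_drop k t) map_cat st1 st2 -b0.
by congr (_ ++ _); apply: eq_map => x; rewrite FinRing.unit_actE ?add0r mulrC.
Qed.

(** * Burnside counting for GL_2 over a finite field *)

(** A tuple is fixed by a exactly when all its entries are, so Burnside's formula on tuples involves
    only k-th powers of fixed point counts. *)
Lemma Frobenius_Cauchy_diag (aT : finGroupType) (T : finType)
    (to : {action aT &-> T}) (G : {group aT}) (X : {set T}) (k : nat) :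
  [acts G, on X | to] ->
  (\sum_(a in G) #|'Fix_(X | to)[a]%g| ^ k = Morb to G X k * #|G|)%N.
Proof.
move=> actsG; rewrite -(Frobenius_Cauchy (acts_diag k actsG)).
apply: eq_bigr => a _; rewrite -card_tuple_all; apply: eq_card => t.
rewrite inE in_setI [in RHS]inE.
apply/all_tnthP/andP => [tXa | [/all_tnthP tX ta] i].
  split; first by apply/all_tnthP => i; case/setIP: (tXa i).
  apply/afix1P/eq_from_tnth => i; rewrite tnth_map.
  by case/setIP: (tXa i) => _ /afix1P.
move/afix1P: ta => ta; rewrite in_setI [_ \in X]tX; apply/afix1P.
by rewrite -[in RHS]ta tnth_map.
Qed.

(** In the rank factorisation of v, the right factor is 1 x 1, hence a nonzero scalar c that can be
    absorbed into the left factor; [pid_mx 1] is the first basis vector. *)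
Lemma col_action_trans (F : finFieldType) (v : 'cV[F]_2) :
  v != 0 -> v \in orbit (col_action F) 'GL_2[F] (pid_mx 1).
Proof.
move=> v0; pose c := row_ebase v 0 0.
have c0 : c != 0.
  have := row_ebase_unit v; rewrite unitmxE.
  by rewrite [row_ebase v]mx11_scalar det_scalar1 unitfE.
have rv : \rank v = 1%N.
  by apply/eqP; rewrite eqn_leq rank_leq_col lt0n mxrank_eq0.
have uL : c *: col_ebase v \in unitmx by rewrite unitmxZ ?unitfE ?col_ebase_unit.
rewrite orbit_left_action; apply/imsetP; exists (Sub (c *: col_ebase v) uL).
  by rewrite inE.
rewrite /col_mul -[in LHS](mulmx_ebase v) rv [row_ebase v]mx11_scalar.
by rewrite mul_mx_scalar -scalemxAl.
Qed.

Lemma card_orbit_col_action (F : finFieldType) :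
  #|orbit (col_action F) 'GL_2[F] @: [set: 'cV[F]_2]| = 2.
Proof.
pose e : 'cV[F]_2 := pid_mx 1.
have e0 : e != 0 by rewrite -mxrank_eq0 rank_pid_mx.
have o0 : orbit (col_action F) 'GL_2[F] 0 = [set 0].
  apply/setP => w; rewrite orbit_left_action inE.
  apply/imsetP/eqP => [[g _ ->]|->]; first by rewrite /col_mul mulmx0.
  by exists 1%g; rewrite ?inE // col_mul1.
rewrite (_ : _ @: _ = [set orbit (col_action F) 'GL_2[F] 0;
                           orbit (col_action F) 'GL_2[F] e]).
  rewrite cards2 o0; case: eqP => // /setP/(_ e).
  by rewrite orbit_refl inE (negPf e0).
apply/setP => O; rewrite !inE; apply/imsetP/orP => [[v _ ->]|].
  have [->|v0] := eqVneq v 0; [by left | right].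
  by rewrite -(orbit_eqP (col_action_trans v0)).
by case=> /eqP->; [exists 0 | exists e]; rewrite ?inE.
Qed.

Lemma card_fix_col_action (F : finFieldType) (g : {'GL_2[F]}) :
  [\/ g = 1%g /\ #|'Fix_([set: 'cV[F]_2] | col_action F)[g]%g| = (#|F| ^ 2)%N,
      g != 1%g /\ #|'Fix_([set: 'cV[F]_2] | col_action F)[g]%g| = #|F| |
      g != 1%g /\ #|'Fix_([set: 'cV[F]_2] | col_action F)[g]%g| = 1%N].
Proof.
(* The fixed space is the kernel of g^-1 - 1, of dimension 2 minus the rank. The inverse comes from
   the right action convention, the transpose from [kermx] being a kernel on row vectors. *)
pose A := (GLval g^-1%g - 1%:M)^T.
have cardE : #|'Fix_([set: 'cV[F]_2] | col_action F)[g]%g| = (#|F| ^ \rank (kermx A))%N.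
  rewrite setTI -card_rowg -(card_imset _ (@trmx_inj F 2 1)).
  apply: eq_card => w; rewrite mem_rowg; apply/imsetP/sub_kermxP => [[v]|wA].
    move/afix1P; rewrite left_actionE /col_mul => gv ->.
    by rewrite -trmx_mul mulmxBl gv mul1mx subrr trmx0.
  exists w^T; last by rewrite trmxK.
  apply/afix1P; rewrite left_actionE /col_mul; apply/eqP.
  rewrite -subr_eq0 -[X in _ - X]mul1mx -mulmxBl.
  by rewrite -[_ - _]trmxK -trmx_mul wA trmx0.
have A0 : (A == 0) = (g == 1%g).
  rewrite /A -(inj_eq (@trmx_inj F 2 2)) trmxK trmx0 subr_eq0.
  by rewrite -[RHS]invg_eq1 -(inj_eq val_inj).
have := rank_leq_row A; have := mxrank_eq0 A; rewrite A0 cardE mxrank_ker.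
case: (\rank A) => [|[|[|r]]] //= /esym g1 _.
- by constructor 1; split=> //; apply/eqP.
- by constructor 2; rewrite g1.
by constructor 3; rewrite g1.
Qed.

Lemma sum_fix_col_action (F : finFieldType) : exists a0 a1 : nat, forall k,
  (\sum_(g in 'GL_2[F]%g) #|'Fix_([set: 'cV[F]_2] | col_action F)[g]%g| ^ k
     = a0 + a1 * #|F| ^ k + #|F| ^ (2 * k))%N.
Proof.
pose P (g : {'GL_2[F]}) := #|'Fix_([set: 'cV[F]_2] | col_action F)[g]%g| == #|F|.
(* The numbers of g other than 1 with one fixed vector and with q fixed vectors. *)
exists #|[pred g | (g != 1%g) && ~~ P g]|, #|[pred g | (g != 1%g) && P g]| => k.
rewrite (bigD1 1%g) ?inE //= addnC; congr (_ + _)%N; last first.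
  by case: (@card_fix_col_action F 1%g) => [[_ ->]|[]|[]]; rewrite ?eqxx ?expnM.
rewrite (bigID P) [LHS]addnC /=; congr (_ + _)%N.
  rewrite -[RHS]sum1_card; apply: eq_big => [g|g /andP[/andP[_ g1] nPg]].
    by rewrite !inE.
  case: (card_fix_col_action g) => [[gE _]|[_ gE]|[_ ->]].
  - by rewrite gE eqxx in g1.
  - by rewrite /P gE eqxx in nPg.
  - by rewrite exp1n.
rewrite -sum_nat_const; apply: eq_big => [g|g /andP[_ /eqP->] //].
by rewrite !inE.
Qed.

Lemma Morb_col_action (F : finFieldType) (k : nat) :
  let q : rat := #|F|%:R in
  (Morb (col_action F) 'GL_2[F] [set: 'cV[F]_2] k)%:R
  = (q ^+ 4 - 2 * q ^+ 3 - q ^+ 2 + 3 * q) / ((q ^+ 2 - q) * (q ^+ 2 - 1))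
    + q ^+ k * ((q ^+ 3 - 2 * q - 1) / ((q ^+ 2 - q) * (q ^+ 2 - 1)))
    + q ^+ (2 * k) * (1 / ((q ^+ 2 - q) * (q ^+ 2 - 1))).
Proof.
move=> q; have q_gt1 : 1 < q by rewrite ltr1n card_finNzRing_gt1.
have actsG : [acts 'GL_2[F]%g, on [set: 'cV[F]_2] | col_action F].
  by apply/actsP => g _ x; rewrite !inE.
have [a0 [a1 sumE]] := sum_fix_col_action F.
have natE m n : m = n -> m%:R = n%:R :> rat by move->.
have GE : #|'GL_2[F]%g|%:R = q * (q - 1) ^+ 2 * (q + 1).
  rewrite card_GL_2 !natrM -expr2 -[#|F|.+1]addn1 natrD -subn1 natrB //.
  by rewrite ltnW // card_finNzRing_gt1.
(* Exponent 0 counts the group; exponent 1, with two orbits, gives twice its order. *)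
have := natE _ _ (sumE 0); rewrite sum_nat_const muln1 GE => e0.
have := natE _ _ (sumE 1); rewrite Frobenius_Cauchy // card_orbit_col_action.
rewrite natrM GE => e1.
have := natE _ _ (sumE k); rewrite Frobenius_Cauchy_diag // natrM GE.
rewrite !(natrD, natrM, natrX) in e0 e1 *; rewrite -/q in e0 e1 *.
set M := _%:R; set Q := q ^+ k; rewrite [(2 * k)%N]mulnC exprM -/Q => eM.
have q1 : q - 1 != 0 by rewrite subr_eq0 gt_eqF.
(* Subtracting [e0] from [e1] leaves |G| = (q - 1) a1 + q^2 - 1, from which q - 1 cancels. *)
have a1E : a1%:R = q ^+ 3 - 2 * q - 1.
  by apply: (mulfI q1); move: e0 e1; rewrite !expr1 !expr0 => e0 e1; lra.
have a0E : a0%:R = q * (q - 1) ^+ 2 * (q + 1) - a1%:R - 1 by lra.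
have q0 : q != 0 by rewrite gt_eqF //; lra.
have q2 : q + 1 != 0 by rewrite gt_eqF //; lra.
have G0 : q * (q - 1) ^+ 2 * (q + 1) != 0 by rewrite !mulf_neq0 // expf_neq0.
apply: (mulIf G0); rewrite eM a0E a1E.
have -> : (q ^+ 2 - q) * (q ^+ 2 - 1) = q * (q - 1) ^+ 2 * (q + 1) by ring.
by field; rewrite q0 q1 q2.
Qed.

Theorem theorem1p8 (k n : nat) (k_gt0 : (0 < k)%N) (n_gt0 : (0 < n)%N) :
  [/\ (Morb 'U%act (units_Zp_group n) (Zp n) k)%:R = Msum k n,
      (Morb (col_pair_action 'Z_n) (affine_group n) (affine_pairs n) k)%:R
        = Msum (2 * k - 1)%N n
    & forall l : nat, prime l ->
        let q : rat := l%:R in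
        (Morb (col_action 'F_l) 'GL_2['F_l] [set: 'cV['F_l]_2] k)%:R
        = (q ^+ 4 - 2 * q ^+ 3 - q ^+ 2 + 3 * q)
            / ((q ^+ 2 - q) * (q ^+ 2 - 1))
          + q ^+ k * ((q ^+ 3 - 2 * q - 1) / ((q ^+ 2 - q) * (q ^+ 2 - 1)))
          + q ^+ (2 * k) * (1 / ((q ^+ 2 - q) * (q ^+ 2 - 1)))].
Proof.
split; first exact: Morb_units_Zp.
  (* After k is replaced by k + 1, the exponent 2 (k + 1) - 1 is k + (k + 1). *)
  case: k k_gt0 => // k _; rewrite Morb_affine Morb_units_Zp //.
  by congr (Msum _ n); lia.
by move=> l l_pr q; have := Morb_col_action 'F_l k; rewrite card_Fp.
Qed.
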